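(* Let $\mathcal{L}=\{l_1,\dots,l_s\}$ be a set of $s$ nonnegative integers with $l_{1} < l_{2} < \cdots <l_{s}$ and $\mathbb{F}_{q}$ be a finite field of order $q$. Suppose that $\mathcal{V} = \{V_{1}, \ldots, V_{m}\}$ is a collection of subspaces of an $n$-dimensional vector space over $\mathbb{F}_{q}$ such that $\mathrm{dim}(V_{i} \cap V_{j}) \in \mathcal{L}$ for any distinct $V_{i}, V_{j}\in\mathcal{V}$, and the dimension of every member of $\mathcal{V}$ belongs to $\{k_{1}, \ldots, k_{r}\}$ with $k_{i} > s - r + l_{1}$ for every $i$. Let $k = \max\{\dim(V_{j}) : 1 \le j \le m\}$. If $n \ge \log_{q}\big((q^{s} - 1)\binom{k^{2}}{l_{1} + 1}_{q} + 1\big) + l_{1}$, then \[ |\mathcal{V}| \le \binom{n - l_{1}}{s}_{q} + \binom{n - l_{1}}{s - 1}_{q} + \cdots + \binom{n - l_{1}}{s - r + 1}_{q}. \]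
   Context: Here $\binom{n}{k}_{q} := \prod_{0 \le i \leq k - 1} \frac{q^{n - i}-1}{q^{k - i}-1}$ denotes the Gaussian binomial coefficient, i.e. the number of $k$-dimensional subspaces of an $n$-dimensional vector space over $\mathbb{F}_q$; $q$ is a prime power. *)

(* Defs.v *)
From HB Require Import structures.
From mathcomp Require Import all_boot all_order all_algebra.
From mathcomp Require Import reals exp.

Set Implicit Arguments.
Unset Strict Implicit.
Unset Printing Implicit Defensive.

Import Order.TTheory GRing.Theory Num.Theory.
Local Open Scope ring_scope.

(* The subtraction [n - i] is truncated; this is harmless, because for [n < k]
   the factor [i = n] makes the product vanish anyway. *)
Definition gauss_binom (R : fieldType) (q n k : nat) : R :=
  \prod_(i < k) ((q%:R ^+ (n - i) - 1) / (q%:R ^+ (k - i) - 1)).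

Definition log_base (R : realType) (b x : R) : R := ln x / ln b.

(* Main.v *)
Require Import Defs.
From HB Require Import structures.
From mathcomp Require Import all_boot all_order all_algebra.
From mathcomp Require Import reals exp.
From mathcomp Require Import finfield zify.

(* For a subspace W of dimension d contained in every member, intersecting with
   a complement of W reduces to the case d = 0, which is the q-analogue of the
   Alon-Babai-Suzuki theorem: in the space of functions U |-> f(U) on subspaces,
   the polynomials prod_l (q^dim(V :&: U) - q^l), for V in the family, together
   with [I <= U] * prod_i (q^dim U - q^k_i), for dim I <= s - r, are linearly
   independent in the span of the indicators [T <= U] with dim T <= s.
   This settles families whose common intersection has dimension at least l_1.
   Otherwise, adding up members while their intersection shrinks below dimension
   l_1 gives a subspace M with dim M <= k^2 that meets every member in at least
   l_1 + 1 dimensions. The members through a given (l_1 + 1)-dimensional subspace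
   of M are bounded by the first case with L minus l_1, and the lower bound on n
   absorbs the factor [k^2 choose l_1 + 1]_q. *)

Set Implicit Arguments.
Unset Strict Implicit.
Unset Printing Implicit Defensive.

Import Order.TTheory GRing.Theory Num.Theory.
Local Open Scope ring_scope.

(** * Finiteness of the set of subspaces, via their matrices *)

HB.instance Definition _ (F : finFieldType) (vT : vectType F) :=
  isCountable.Build {vspace vT}
    (pcan_pickleK (can_pcan VectorInternalTheory.vs2mxK)).
HB.instance Definition _ (F : finFieldType) (vT : vectType F) :=
  isFinite.Build {vspace vT}
    (pcan_enumP (can_pcan (@VectorInternalTheory.vs2mxK F vT))).

(** * Gaussian binomials *)

Section GaussBinomial.

Variables (R : realFieldType) (q : nat).
Hypothesis q_gt1 : (1 < q)%N.

Let expq_ge1 i : 1 <= q%:R ^+ i :> R.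
Proof. by rewrite exprn_ege1 // ler1n ltnW. Qed.

Let expq_gt1 i : (0 < i)%N -> 1 < q%:R ^+ i :> R.
Proof. by move=> i_gt0; rewrite exprn_egt1 ?ltr1n // -lt0n. Qed.

Lemma gauss_binom_ge0 n k : 0 <= gauss_binom R q n k.
Proof.
by apply: prodr_ge0 => i _; rewrite divr_ge0 // subr_ge0 expq_ge1.
Qed.

Lemma gauss_binom_ge1 n k : (k <= n)%N -> 1 <= gauss_binom R q n k.
Proof.
move=> le_kn; have <- : \prod_(i < k) 1 = 1 :> R by rewrite big1.
apply: ler_prod => i _; rewrite ler01 ler_pdivlMr ?subr_gt0 ?expq_gt1 ?subn_gt0 //.
by rewrite mul1r lerB // ler_weXn2l ?leq_sub2r // ler1n ltnW.
Qed.

Lemma leq_gauss_binom m n k :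
  (m <= n)%N -> gauss_binom R q m k <= gauss_binom R q n k.
Proof.
move=> le_mn; apply: ler_prod => i _.
rewrite divr_ge0 ?subr_ge0 ?expq_ge1 //= ler_wpM2r ?invr_ge0 ?subr_ge0 //.
by rewrite lerB // ler_weXn2l ?leq_sub2r // ler1n ltnW.
Qed.

Lemma gauss_binomS n k : gauss_binom R q n k.+1 =
  (q%:R ^+ n - 1) / (q%:R ^+ k.+1 - 1) * gauss_binom R q n.-1 k.
Proof.
rewrite /gauss_binom big_ord_recl !subn0; congr (_ * _).
by apply: eq_bigr => i _; rewrite lift0 subSS -predn_sub -subnS -add1n subnDA subn1.
Qed.

(** For k <= n both sides count independent k-tuples: choose a k-subspace, then an ordered basis of
    it. *)
Lemma gauss_binom_prod n k :
  gauss_binom R q n k * (\prod_(i < k) (q ^ k - q ^ i))%N%:R =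
  (\prod_(i < k) (q ^ n - q ^ i))%N%:R.
Proof.
rewrite !natr_prod -big_split /=; have [le_kn | lt_nk] := leqP k n.
  apply: eq_bigr => i _.
  have split_exp m : (k <= m)%N ->
      (q ^ m - q ^ i)%N%:R = q%:R ^+ i * (q%:R ^+ (m - i) - 1) :> R.
    move=> le_km; have le_im: (i <= m)%N by apply: ltnW (leq_trans _ le_km).
    by rewrite natrB ?leq_pexp2l ?(ltnW q_gt1) // !natrX mulrBr mulr1 -exprD subnKC.
  rewrite !split_exp // mulrCA divfK // gt_eqF // subr_gt0 expq_gt1 //.
  by rewrite subn_gt0.
(* For n < k the factor i = n vanishes on both sides. *)
rewrite (bigD1 (Ordinal lt_nk)) //= [in RHS](bigD1 (Ordinal lt_nk)) //=.
by rewrite !subnn expr0 subrr !mul0r.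
Qed.

End GaussBinomial.

(** * Counting independent tuples and subspaces *)

Section Counting.

Variables (F : finFieldType) (vT : vectType F).
Local Notation fvT := (finvect_type vT).
Local Notation q := #|F|.
Implicit Types (U V M T : {vspace fvT}).

Lemma card_finField_gt1 : (1 < q)%N.
Proof. exact: finNzRing_gt1. Qed.
Let q_gt1 := card_finField_gt1.

Definition free_tuples j U : {set j.-tuple fvT} :=
  [set X : j.-tuple fvT | free X && (<<X>> <= U)%VS].

(** A free j-tuple extends by any vector of U outside its span, which leaves q^dim U - q^j
    choices. *)
Lemma card_free_tuples j U :
  #|free_tuples j U| = (\prod_(i < j) (q ^ \dim U - q ^ i))%N.
Proof.
elim: j => [|j IHj].
  rewrite big_ord0 (_ : free_tuples 0 U = setT) ?cardsT ?card_tuple //.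
  by apply/setP=> X; rewrite !inE tuple0 nil_free span_nil sub0v.
rewrite big_ord_recr /= -IHj -sum_nat_const -sum1_card.
pose tail (X : j.+1.-tuple fvT) : j.-tuple fvT := [tuple of behead X].
rewrite (partition_big tail (mem (free_tuples j U))) /=; last first.
  move=> X; rewrite !inE; case/tupleP: X => v X /=.
  by rewrite free_cons span_cons subv_add => /andP[/andP[_ ->] /andP[_ ->]].
apply: eq_bigr => X /[!inE] /andP[freeX subXU].
have <-: #|[pred v : fvT | (v \in U) && (v \notin <<X>>%VS)]| = (q ^ \dim U - q ^ j)%N.
  rewrite -[j in RHS](size_tuple X) -(eqP freeX) -!card_vspace.
  rewrite -(cardID <<X>>%VS U) (_ : #|[predI U & _]| = #|<<X>>%VS|).
    rewrite addKn; apply: eq_card => v; rewrite !inE; exact: andbC.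
  apply: eq_card => v; rewrite !inE.
  by case: (boolP (v \in <<X>>%VS)) => [/(subvP subXU)->|]; rewrite ?andbF.
rewrite sum1_card -(card_image (f := fun v => [tuple of v :: X])) => [|u v [] //].
apply: eq_card => Y; rewrite unfold_in /= inE; apply/idP/imageP => [|[v + ->]].
  case/tupleP: Y => v Y /=; rewrite free_cons span_cons subv_add.
  case/andP=> /andP[/andP[v'Y _] /andP[vU _]] /eqP/(congr1 val)/= eYX.
  have {}eYX: Y = X by apply: val_inj.
  by exists v; [rewrite inE memvE vU -eYX | apply: val_inj; rewrite /= eYX].
rewrite !inE; case/andP=> vU v'X.
rewrite /= free_cons v'X freeX span_cons subv_add subXU.
by rewrite -memvE vU; apply/eqP/val_inj.
Qed.

(* Double counting of the pairs (V, X) with X a linearly independent j-tuple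
   of vectors of V :&: M. *)
Lemma size_cover_bound (R : realFieldType) (B : R) j M (VV : seq {vspace fvT}) :
  (forall V, V \in VV -> (j <= \dim (V :&: M))%N) ->
  (forall T, (T <= M)%VS -> \dim T = j ->
     (count (fun V => (T <= V)%VS) VV)%:R <= B) ->
  (size VV)%:R <= gauss_binom R q (\dim M) j * B.
Proof.
move=> meetM boundB; set c := (\prod_(i < j) (q ^ j - q ^ i))%N.
have c_gt0: 0 < c%:R :> R.
  by rewrite ltr0n prodn_gt0 // => i; rewrite subn_gt0 ltn_exp2l.
rewrite -(ler_pM2r c_gt0) mulrAC gauss_binom_prod // -card_free_tuples.
have -> : (size VV)%:R * c%:R = \sum_(V <- VV) c%:R :> R.
  by rewrite big_const_seq count_predT iter_addr_0 mulr_natl.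
rewrite mulr_natl -sumr_const.
apply: (@le_trans _ _ (\sum_(V <- VV) \sum_(X in free_tuples j M | (<<X>> <= V)%VS) 1%:R)).
  rewrite big_seq [leRHS]big_seq; apply: ler_sum => V VVV.
  rewrite -natr_sum ler_nat sum1_card.
  have -> : #|[pred X in free_tuples j M | (<<X>> <= V)%VS]| =
            #|free_tuples j (V :&: M)%VS|.
    by apply: eq_card => X; rewrite !inE subv_cap -andbA [X in _ && X]andbC.
  rewrite card_free_tuples; apply: leq_prod => i _.
  by rewrite leq_sub2r // leq_pexp2l ?meetM // ltnW.
(* Each X spans a j-dimensional T <= M, so [boundB] limits the number of V above it. *)
rewrite (exchange_big_dep (mem (free_tuples j M))) /=; last by move=> V X _ /andP[].
apply: ler_sum => X; rewrite inE => /andP[freeX subXM].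
have := boundB _ subXM; rewrite (eqP freeX) size_tuple => /(_ erefl).
rewrite -natr_sum -sum1_count; apply: le_trans; rewrite ler_nat.
rewrite leq_eqVlt; apply/orP; left; apply/eqP/eq_bigl=> V.
by rewrite freeX subXM.
Qed.

(** The covering bound applied to the j-subspaces themselves, with B = 1: the only one containing T
    is T. *)
Lemma card_subspaces_le (R : realFieldType) j M :
  (#|[set T : {vspace fvT} | (T <= M)%VS & \dim T == j]|)%:R <=
    gauss_binom R q (\dim M) j.
Proof.
rewrite cardE -[leRHS]mulr1; apply: size_cover_bound => [V | T subTM dimT].
  by rewrite mem_enum inE => /andP[/capv_idPl-> /eqP->].
rewrite lern1 -size_filter.
apply: (@uniq_leq_size _ _ [:: T]); first exact/filter_uniq/enum_uniq.
move=> V; rewrite mem_filter mem_enum !inE => /and3P[subTV _ /eqP dimV].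
by rewrite eq_sym eqEdim subTV dimT dimV /=.
Qed.

End Counting.

(** * The Alon-Babai-Suzuki bound for subspaces *)

Section FunctionSpace.

Variables (K : fieldType) (I : finType).
Local Notation fun_space := {ffun I -> K^o}.
Implicit Types (X : seq fun_space) (V : {vspace fun_space}).

Lemma ffun_mul_span (w : I -> K) X V :
  (forall f, f \in X -> [ffun i => f i * w i] \in V) ->
  forall f, f \in <<X>>%VS -> [ffun i => f i * w i] \in V.
Proof.
move=> XwV f /(coord_span (X := in_tuple X)) ->.
have -> : [ffun i => (\sum_j coord (in_tuple X) j f *: (in_tuple X)`_j) i * w i] =
   \sum_j coord (in_tuple X) j f *: [ffun i => (in_tuple X)`_j i * w i] :> fun_space.
  apply/ffunP=> i; rewrite ffunE !sum_ffunE mulr_suml; apply: eq_bigr => j _.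
  by rewrite !ffunE -scalerAl.
by apply: rpred_sum => j _; rewrite rpredZ // XwV // mem_nth.
Qed.

Lemma span_vanish i X : (forall f, f \in X -> f i = 0) ->
  forall f, f \in <<X>>%VS -> f i = 0.
Proof.
move=> Xi0 f /(coord_span (X := in_tuple X)) ->; rewrite sum_ffunE big1 // => j _.
by rewrite ffunE Xi0 ?scaler0 // mem_nth.
Qed.

(** The evaluation matrix is triangular: the head is nonzero at a point where all later functions
    vanish. *)
Lemma triangular_free (J : eqType) (Z : seq J) (x : J -> I) (f : J -> fun_space) :
  (forall z, z \in Z -> f z (x z) != 0) ->
  pairwise (fun y z => f z (x y) == 0) Z -> free (map f Z).
Proof.
elim: Z => [|z Z IHZ] /= Znz; first by rewrite nil_free.
case/andP=> /allP z0 pZ; rewrite free_cons IHZ // => [|y yZ]; last first.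
  by rewrite Znz // inE yZ orbT.
rewrite andbT; apply: contra (Znz z (mem_head _ _)) => /span_vanish-> // g.
by case/mapP=> y /z0/eqP yz ->.
Qed.

End FunctionSpace.

Section AlonBabaiSuzuki.

Variables (R : realFieldType) (F : finFieldType) (vT : vectType F).
Local Notation fvT := (finvect_type vT).
Local Notation subspace := {vspace fvT}.
Local Notation fun_space := {ffun subspace -> R^o}.
Local Notation q := #|F|.
Implicit Types (T U V E : subspace).

Let q_gt1 : (1 < q)%N := card_finField_gt1 F.

Definition ind_above T : fun_space := [ffun U => (T <= U)%VS%:R].

(** The analogue of the polynomials of degree at most [s]. *)
Definition ind_space E s : {vspace fun_space} :=
  <<[seq ind_above T | T <- enum [set T | (T <= E)%VS & (\dim T <= s)%N]]>>%VS.

Definition annihilator V (L : seq nat) T : fun_space :=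
  [ffun U => ind_above T U * \prod_(l <- L) ((q ^ \dim (V :&: U)) %:R - (q ^ l)%:R)].

Lemma ind_above_in E s T : (T <= E)%VS -> (\dim T <= s)%N ->
  ind_above T \in ind_space E s.
Proof. by move=> sTE dT; apply/memv_span/map_f; rewrite mem_enum inE sTE. Qed.

(** [T <= U] * q^dim(V :&: U) is the sum over v in V of [T + <v> <= U], and adding a line raises dim
    T by at most one. *)
Lemma ind_space_mul E s V (c : R) f : (V <= E)%VS -> f \in ind_space E s ->
  [ffun U => f U * ((q ^ \dim (V :&: U))%:R - c)] \in ind_space E s.+1.
Proof.
move=> sVE; apply: ffun_mul_span => _ /mapP[T + ->].
rewrite mem_enum inE => /andP[sTE dT].
have -> : [ffun U => ind_above T U * ((q ^ \dim (V :&: U))%:R - c)] =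
    \sum_(v : fvT | v \in V) ind_above (T + <[v]>) - c *: ind_above T :> fun_space.
  apply/ffunP=> U; rewrite !ffunE sum_ffunE mulrBr [c *: _]mulrC; congr (_ - _).
  rewrite -card_vspace -sum1_card natr_sum mulr_sumr.
  rewrite [LHS](eq_bigl (fun v => (v \in V) && (v \in U))); last first.
    by move=> v; rewrite memv_cap.
  rewrite big_mkcondr; apply: eq_bigr => v _.
  by rewrite ffunE subv_add -memvE; case: (v \in U); rewrite ?andbT ?andbF ?mulr1.
rewrite rpredB ?rpredZ ?ind_above_in // ?leqW // rpred_sum // => v vV.
rewrite ind_above_in ?subv_add ?sTE -?memvE ?(subvP sVE) //.
have [le_d _] := dimv_add_leqif T <[v]>; apply: (leq_trans le_d).
by rewrite dim_vline addnC; case: (v != 0); rewrite // leqW.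
Qed.

Lemma annihilator_in E V T L s : (V <= E)%VS -> (T <= E)%VS ->
  (\dim T + size L <= s)%N -> annihilator V L T \in ind_space E s.
Proof.
move=> sVE sTE; elim: L s => [|l L IHL] s /=; rewrite ?addn0 ?addnS.
  move=> dT; rewrite (_ : annihilator _ _ _ = ind_above T) ?ind_above_in //.
  by apply/ffunP=> U; rewrite ffunE big_nil mulr1.
case: s => // s ds.
suff -> : annihilator V (l :: L) T =
    [ffun U => annihilator V L T U * ((q ^ \dim (V :&: U))%:R - (q ^ l)%:R)].
  exact: ind_space_mul sVE (IHL s ds).
by apply/ffunP=> U; rewrite !ffunE big_cons mulrA mulrAC.
Qed.

Lemma annihilator_eq0 V L T U :
  (annihilator V L T U == 0) = ~~ (T <= U)%VS || (\dim (V :&: U) \in L).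
Proof.
rewrite !ffunE mulf_eq0 pnatr_eq0 eqb0 prodf_seq_eq0; congr (_ || _).
rewrite -has_pred1; apply: eq_has => l /=.
by rewrite subr_eq0 eqr_nat eqn_exp2l // eq_sym.
Qed.

(* The functions f_V = annihilator V {l in L | l < dim V} 0 for V in VV and
   h_I = annihilator E K I for dim I <= s - r are linearly independent inside
   the span of the indicators [T <= U] with dim T <= s. *)
Lemma size_family_le_card E (VV : seq subspace) (L K : seq nat) :
  uniq VV ->
  (forall V, V \in VV -> (V <= E)%VS) ->
  (forall V W, V \in VV -> W \in VV -> V != W -> \dim (V :&: W) \in L) ->
  (forall V, V \in VV -> \dim V \in K) ->
  (forall k, k \in K -> (size L < k + size K)%N) ->
  (size VV <= #|[set T : subspace | (T <= E)%VS &
                   (\dim T <= size L < \dim T + size K)%N]|)%N.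
Proof.
move=> uVV VVE capL dimK Kgt; set s := size L; set r := size K.
pose by_dim := relpre (fun V : subspace => \dim V) leq.
have by_dim_tr : transitive by_dim by move=> U V W; apply: leq_trans.
have by_dim_tot : total by_dim by move=> U V; apply: leq_total.
pose II := enum [set T : subspace | (T <= E)%VS & (\dim T + r <= s)%N].
have IIP T : T \in II = (T <= E)%VS && (\dim T + r <= s)%N by rewrite mem_enum inE.
have sorted_pairs (X : seq subspace) : uniq X ->
    pairwise (fun U V => (\dim U <= \dim V)%N && (U != V)) (sort by_dim X).
  move=> uX; rewrite pairwise_relI -sorted_pairwise // sort_sorted //=.
  by rewrite -uniq_pairwise sort_uniq.
pose f z : fun_space := if z.1 then annihilator E K z.2
  else annihilator z.2 [seq l <- L | (l < \dim z.2)%N] 0%VS.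
(* Triangular order: the members by increasing dimension, then the small subspaces by increasing
   dimension, each evaluated at itself. *)
pose Z := map (pair false) (sort by_dim VV) ++ map (pair true) (sort by_dim II).
have freeZ : free (map f Z).
  apply: (@triangular_free _ _ _ Z snd f) => [z|].
    rewrite mem_cat => /orP[] /mapP[V + ->] /=; rewrite mem_sort => Vin.
      by rewrite annihilator_eq0 sub0v capvv mem_filter ltnn.
    (* By [Kgt], dim I + r <= s keeps dim I out of [K], so h_I(I) is nonzero. *)
    move: Vin; rewrite IIP annihilator_eq0 subvv => /andP[/capv_idPr-> /= dV].
    by apply/negP=> /Kgt; rewrite ltnNge dV.
  rewrite pairwise_cat !pairwise_map; apply/and3P; split.
  - apply/allrelP=> _ _ /mapP[V + ->] /mapP[T _ ->] /=; rewrite mem_sort => Vin.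
    by rewrite annihilator_eq0 (capv_idPr (VVE _ Vin)) dimK ?orbT.
  - have := sorted_pairs VV uVV; apply: (sub_in_pairwise (P := mem VV)).
      move=> U V /= UVV VVV /andP[dUV neUV]; rewrite annihilator_eq0.
      (* If V :&: U had dimension dim V, then V <= U, and dim U <= dim V would force U = V. *)
      rewrite mem_filter capL // 1?eq_sym // andbT ltnNge; apply/orP; right.
      apply: contra neUV => dV; have eqV: (V :&: U)%VS = V.
        by apply/eqP; rewrite eqEdim capvSl.
      by rewrite eq_sym eqEdim dUV -{1}eqV capvSr.
    by apply/allP=> V; rewrite mem_sort.
  - have := sorted_pairs II (enum_uniq _); apply: sub_pairwise => U V /= /andP[dUV neUV].
    rewrite annihilator_eq0; apply/orP; left.
    by apply: contra neUV => sVU; rewrite eq_sym eqEdim sVU.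
have subZ : (<<map f Z>> <= ind_space E s)%VS.
  apply/span_subvP=> _ /mapP[z + ->]; rewrite mem_cat.
  case/orP=> /mapP[V + ->]; rewrite mem_sort => Vin /=.
    rewrite annihilator_in ?sub0v ?VVE //.
    by rewrite dimv0 size_filter count_size.
  by move: Vin; rewrite IIP => /andP[sVE dV]; rewrite annihilator_in.
have := leq_trans (dimvS subZ) (dim_span _).
(* Independence bounds |VV| + |II| by the number of T with dim T <= s; removing [II] leaves the
   layers s - r < dim T <= s. *)
rewrite (eqP freeZ) !size_map size_cat !size_map !size_sort -!cardE.
set A := [set T | _]; set B := [set T | _ & (_ + _ <= _)%N]; set C := [set T | _].
have -> : C = A :\: B.
  apply/setP=> T; rewrite !inE negb_and -ltnNge.
  by case: (T <= E)%VS; rewrite //= andbC.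
rewrite cardsD (setIidPr _).
  by move=> leA; rewrite -(leq_add2r #|B|) subnK // (leq_trans (leq_addl _ _) leA).
apply/subsetP=> T; rewrite !inE => /andP[-> dT] /=.
exact: leq_trans (leq_addr _ _) dT.
Qed.

Lemma alon_babai_suzuki E (VV : seq subspace) (L K : seq nat) :
  uniq VV ->
  (forall V, V \in VV -> (V <= E)%VS) ->
  (forall V W, V \in VV -> W \in VV -> V != W -> \dim (V :&: W) \in L) ->
  (forall V, V \in VV -> \dim V \in K) ->
  (forall k, k \in K -> (size L < k + size K)%N) ->
  (size VV)%:R <= \sum_(i < size K | (i <= size L)%N)
                    gauss_binom R q (\dim E) (size L - i).
Proof.
move=> uVV VVE capL dimK Kgt.
have := size_family_le_card uVV VVE capL dimK Kgt.
set s := size L; set r := size K; set A := [set T | _] => leA.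
apply: le_trans (_ : #|A|%:R <= _); first by rewrite ler_nat.
case: (posnP r) => [r0 | r_gt0].
  rewrite (_ : A = set0) ?cards0 ?sumr_ge0 // => [i _|].
    exact: gauss_binom_ge0.
  by apply/setP=> T; rewrite !inE r0 addn0; case: leqP; rewrite ?andbF.
rewrite -(prednK r_gt0).
(* Split by i = s - dim T < r; [inord] needs r > 0, hence the separate case r = 0. *)
rewrite -sum1_card (partition_big (fun T : subspace => inord (s - \dim T) : 'I_r.-1.+1)
  (fun i => (i <= s)%N)) /=; last first.
  move=> T; rewrite inE => /and3P[_ dT sT]; rewrite inordK ?leq_subr //; lia.
rewrite natr_sum; apply: ler_sum => i le_is.
apply: le_trans (card_subspaces_le R _ E); rewrite sum1_card ler_nat.
apply/subset_leq_card/subsetP=> T; rewrite unfold_in /= !inE.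
case/andP=> /and3P[-> dT sT] /eqP/(congr1 val) /=; rewrite inordK; lia.
Qed.

End AlonBabaiSuzuki.

(** * Stars and small covers *)

Lemma subspace_of_dim (K : fieldType) (vT : vectType K) (U : {vspace vT}) j :
  (j <= \dim U)%N -> exists2 W : {vspace vT}, (W <= U)%VS & \dim W = j.
Proof.
move=> le_jU; have := basis_free (vbasisP U).
rewrite -{1}(cat_take_drop j (vbasis U)) => /catl_free freeW.
exists <<take j (vbasis U)>>%VS.
  by apply/span_subvP=> v /mem_take; apply: vbasis_mem.
by rewrite (eqP freeW) size_takel // size_tuple.
Qed.

Lemma dimv_cap_complement (K : fieldType) (vT : vectType K) (W V : {vspace vT}) :
  (W <= V)%VS -> \dim (V :&: W^C) = (\dim V - \dim W)%N.
Proof.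
move=> sWV; have := dimv_sum_cap V W^C.
have -> : (V + W^C = fullv)%VS.
  by apply/eqP; rewrite eqEsubv subvf -(addv_complf W) addvS.
by rewrite dimv_compl; have := dimvS (subvf W); lia.
Qed.

(* Two subspaces meeting every V in at least l dimensions: if V meets their sum
   in only l dimensions then all three intersections coincide. *)
Lemma cover_step (K : fieldType) (vT : vectType K) (U M V C : {vspace vT}) l :
  (l <= \dim (V :&: M))%N -> (l <= \dim (V :&: U))%N ->
  ((\dim (V :&: M) <= l)%N -> (V :&: M <= C)%VS) ->
  (\dim (V :&: (M + U)) <= l)%N -> (V :&: (M + U) <= C :&: U)%VS.
Proof.
move=> VM VU subC dl.
have sM : (V :&: M <= V :&: (M + U))%VS by rewrite capvS ?addvSl.
have sU : (V :&: U <= V :&: (M + U))%VS by rewrite capvS ?addvSr.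
have eqM : (V :&: M)%VS = (V :&: (M + U))%VS.
  by apply/eqP; rewrite eqEdim sM (leq_trans dl).
have eqU : (V :&: U)%VS = (V :&: (M + U))%VS.
  by apply/eqP; rewrite eqEdim sU (leq_trans dl).
by rewrite subv_cap -{1}eqM -eqU capvSr andbT subC // eqM.
Qed.

(** Invariant: any V meeting M in only l dimensions has V :&: M <= C. Starting from C = M = V0, pick
    a member U not containing C and pass to C :&: U and M + U: dim C drops, while dim M grows by at
    most k - l. Once dim C < l, no such V is left. *)
Lemma exists_small_cover (K : fieldType) (vT : vectType K)
    (VV : seq {vspace vT}) l k :
  (0 < size VV)%N ->
  (forall U V, U \in VV -> V \in VV -> (l <= \dim (U :&: V))%N) ->
  (forall V, V \in VV -> (\dim V <= k)%N) ->
  (forall W : {vspace vT}, (l <= \dim W)%N -> ~~ all (subsetv W) VV) ->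
  exists2 M : {vspace vT}, (\dim M <= k ^ 2)%N &
    forall V, V \in VV -> (l < \dim (V :&: M))%N.
Proof.
move=> VV_gt0 capl dimk noW.
have l_gt0 : (0 < l)%N.
  case: posnP => // l0; have := noW 0%VS; rewrite l0 => /(_ isT).
  by case/negP; apply/allP=> V _; apply: sub0v.
suff chain m (C M : {vspace vT}) : (\dim C < m)%N ->
    (l <= \dim C <= k)%N -> (\dim M <= k + (k - \dim C) * (k - l))%N ->
    (forall V, V \in VV -> (l <= \dim (V :&: M))%N) ->
    (forall V, V \in VV -> (\dim (V :&: M) <= l)%N -> (V :&: M <= C)%VS) ->
    exists2 M : {vspace vT}, (\dim M <= k ^ 2)%N &
      forall V, V \in VV -> (l < \dim (V :&: M))%N.
  case: VV VV_gt0 capl dimk {noW} chain => // V0 VV _ capl dimk.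
  have VV0 := mem_head V0 VV.
  move/(_ _ V0 V0 (ltnSn _)); apply.
  - by rewrite dimk // -{1}(capvv V0) capl.
  - by rewrite (leq_trans (dimk _ VV0)) ?leq_addr.
  - by move=> V VVV; apply: capl.
  - by move=> V _ _; apply: capvSr.
elim: m C M => // m IHm C M dCm /andP[lC Ck] dM capM capC.
have /allPn[U VVU sCU] := noW C lC.
have dC' : (\dim (C :&: U) < \dim C)%N.
  rewrite ltnNge; apply: contra sCU => dC.
  have <- : (C :&: U)%VS = C by apply/eqP; rewrite eqEdim capvSl.
  exact: capvSr.
have dM' : (\dim (M + U) <= k + (k - \dim C).+1 * (k - l))%N.
  have := dimv_sum_cap M U; have := capM U VVU; rewrite capvC.
  by have := dimk U VVU; rewrite mulSn; lia.
have capM' V : V \in VV -> (l <= \dim (V :&: (M + U)))%N.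
  move=> VVV; apply: leq_trans (capM V VVV) (dimvS _).
  by rewrite capvS ?addvSl.
have capC' V : V \in VV -> (\dim (V :&: (M + U)) <= l)%N ->
    (V :&: (M + U) <= C :&: U)%VS.
  by move=> VVV; apply: cover_step; [apply: capM | apply: capl | apply: capC].
have [lC' | C'l] := leqP l (\dim (C :&: U)).
  apply: (IHm (C :&: U)%VS (M + U)%VS) capM' capC'.
  - exact: leq_trans dC' dCm.
  - by rewrite lC' ltnW // (leq_trans dC').
  - by rewrite (leq_trans dM') // leq_add2l leq_mul2r; lia.
exists (M + U)%VS => [|V VVV].
  (* As 0 < l <= dim C, the bound is at most k + k(k - 1) = k^2. *)
  apply: leq_trans dM' _; rewrite -mulnn -[X in (_ <= X * _)%N](@subnK 1 k); last lia.
  by rewrite mulnDl mul1n addnC leq_add2r mulnC leq_mul; lia.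
rewrite ltnNge; apply/negP=> /(capC' V VVV)/dimvS.
by rewrite leqNgt (leq_trans C'l (capM' V VVV)).
Qed.

(** * Families with and without a large common subspace *)

Section Families.

Variables (R : realFieldType) (F : finFieldType) (vT : vectType F).
Local Notation fvT := (finvect_type vT).
Local Notation subspace := {vspace fvT}.
Local Notation q := #|F|.
Local Notation n := (\dim {:fvT}).

(* V |-> V :&: W^C plays the role of the quotient map V |-> V / W. *)
Lemma size_star_le (W : subspace) (VV : seq subspace) (L K : seq nat) :
  uniq VV ->
  (forall V, V \in VV -> (W <= V)%VS) ->
  (forall U V, U \in VV -> V \in VV -> U != V -> \dim (U :&: V) \in L) ->
  (forall V, V \in VV -> \dim V \in K) ->
  (forall k, k \in K -> (size L + \dim W < k + size K)%N) ->
  (size VV)%:R <= \sum_(i < size K | (i <= size L)%N)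
                    gauss_binom R q (n - \dim W) (size L - i).
Proof.
move=> uVV sWV capL dimK Kgt; set d := \dim W; set C := (W^C)%VS.
rewrite -(size_map (fun V => V :&: C)%VS) -(size_map (subn^~ d) K).
rewrite -(size_map (subn^~ d) L) -dimv_compl.
have capCK V : V \in VV -> (W + V :&: C = V)%VS.
  by move=> /sWV sW; rewrite capvC vspace_modl // addv_complf capfv.
apply: alon_babai_suzuki.
- by rewrite map_inj_in_uniq // => U V UVV VVV eqC; rewrite -(capCK U) // eqC capCK.
- by move=> _ /mapP[V _ ->]; apply: capvSr.
- move=> _ _ /mapP[U UVV ->] /mapP[V VVV ->] neUV.
  have -> : ((U :&: C) :&: (V :&: C) = (U :&: V) :&: C)%VS.
    by rewrite capvA -(capvA U) (capvC C) capvA -capvA capvv.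
  rewrite dimv_cap_complement ?subv_cap ?sWV // (map_f (subn^~ d)) // capL //.
  by apply: contraNneq neUV => ->.
- by move=> _ /mapP[V VVV ->]; rewrite dimv_cap_complement ?sWV // (map_f (subn^~ d)) // dimK.
- by move=> _ /mapP[k /Kgt kK ->]; rewrite !size_map -/d in kK *; lia.
Qed.

(** Distinct members through an (l1 + 1)-dimensional T of the cover meet in more than l1 dimensions,
    so the star bound applies to T with l1 removed from the list. *)
Lemma size_nonstar_le (VV : seq subspace) (l K : seq nat) (l1 k : nat) :
  uniq VV -> (0 < size VV)%N ->
  (forall U V, U \in VV -> V \in VV -> (l1 <= \dim (U :&: V))%N) ->
  (forall U V, U \in VV -> V \in VV -> U != V ->
     (\dim (U :&: V) == l1) || (\dim (U :&: V) \in l)) ->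
  (forall V, V \in VV -> \dim V \in K) ->
  (forall V, V \in VV -> (\dim V <= k)%N) ->
  (forall i, i \in K -> (size l + l1.+1 < i + size K)%N) ->
  (forall W : subspace, (l1 <= \dim W)%N -> ~~ all (subsetv W) VV) ->
  (size VV)%:R <= gauss_binom R q (k ^ 2) l1.+1 *
    \sum_(i < size K | (i <= size l)%N)
       gauss_binom R q (n - l1.+1) (size l - i).
Proof.
move=> uVV VV_gt0 capl1 capl dimK dimk Kgt noW.
have q_gt1 := card_finField_gt1 F.
have [M dM capM] := exists_small_cover VV_gt0 capl1 dimk noW.
have sum_ge0 : 0 <= \sum_(i < size K | (i <= size l)%N)
    gauss_binom R q (n - l1.+1) (size l - i).
  by apply: sumr_ge0 => i _; apply: gauss_binom_ge0.
apply: le_trans (ler_wpM2r sum_ge0 (leq_gauss_binom R q_gt1 l1.+1 dM)).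
apply: size_cover_bound => // T _ dT; rewrite -size_filter -dT.
apply: size_star_le => [|V|U V|V|i]; rewrite ?filter_uniq ?mem_filter //.
- by case/andP.
- case/andP=> TU UVV /andP[TV VVV] neUV; have := capl U V UVV VVV neUV.
  rewrite gtn_eqF // -dT; by rewrite dimvS // subv_cap TU.
- by case/andP=> _; apply: dimK.
- by rewrite dT; apply: Kgt.
Qed.

(** Termwise, with j + 1 = s - i: [N, j+1] / [N-1, j] = (q^N - 1) / (q^(j+1) - 1) >= (q^N - 1) /
    (q^s - 1) >= g. *)
Lemma gauss_binom_sum_mul_le (g : R) (r s N : nat) :
  0 <= g -> (0 < s)%N -> (q%:R ^+ s - 1) * g + 1 <= q%:R ^+ N ->
  g * \sum_(i < r | (i <= s.-1)%N) gauss_binom R q N.-1 (s.-1 - i)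
    <= \sum_(i < r | (i <= s)%N) gauss_binom R q N (s - i).
Proof.
move=> g_ge0 s_gt0 leg; have q_gt1 := card_finField_gt1 F.
rewrite mulr_sumr big_mkcond [leRHS]big_mkcond /=; apply: ler_sum => i _.
case: ifP => le_is; last by case: ifP => // _; apply: gauss_binom_ge0.
have [lt_is ->] : (i < s)%N /\ (i <= s)%N by lia.
have -> : (s - i = (s.-1 - i).+1)%N by lia.
rewrite gauss_binomS // ler_wpM2r ?gauss_binom_ge0 // ler_pdivlMr; last first.
  by rewrite subr_gt0 exprn_egt1 ?ltr1n.
rewrite -lerBrDr in leg; rewrite mulrC; apply: le_trans leg; apply: ler_wpM2r => //.
by rewrite lerB // ler_weXn2l; [|rewrite ler1n ltnW|lia].
Qed.

Lemma size_Lintersecting_le (l K : seq nat) (VV : seq subspace) (l1 k : nat) :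
  uniq VV ->
  path ltn l1 l ->
  (forall U V, U \in VV -> V \in VV -> U != V -> \dim (U :&: V) \in l1 :: l) ->
  (forall V, V \in VV -> \dim V \in K) ->
  (forall V, V \in VV -> (\dim V <= k)%N) ->
  (forall i, i \in K -> ((size l).+1 + l1 < i + size K)%N) ->
  (l1 <= n)%N ->
  (q%:R ^+ (size l).+1 - 1) * gauss_binom R q (k ^ 2) l1.+1 + 1
     <= q%:R ^+ (n - l1) :> R ->
  (size VV)%:R <= \sum_(i < size K | (i <= (size l).+1)%N)
                    gauss_binom R q (n - l1) ((size l).+1 - i).
Proof.
move=> uVV l_sorted capl dimK dimk Kgt l1n leq_n.
have q_gt1 := card_finField_gt1 F.
have [s1|s_gt1] := leqP (size VV) 1.
  apply: le_trans (_ : (size VV > 0)%:R <= _).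
    by rewrite ler_nat; case: size s1 => [|[]].
  case: VV {uVV s1 capl dimk} dimK => [|V VV] dimK.
    by apply: sumr_ge0 => i _; apply: gauss_binom_ge0.
  have VK := dimK V (mem_head _ _); have := Kgt _ VK; have := dimvS (subvf V).
  case: K VK {dimK Kgt} => // k0 K _ Vn Vgt.
  (* One term >= 1 suffices: here [size K] is r - 1, and the last admissible i has s - i <= n - l1
     since s + l1 < dim V + r <= n + r. *)
  rewrite (bigD1 (inord (minn (size l).+1 (size K)))) /=; last by rewrite inordK; lia.
  rewrite ler_wpDr ?sumr_ge0 // => [i _|]; first exact: gauss_binom_ge0.
  by rewrite gauss_binom_ge1 // inordK; rewrite /= in Vgt; lia.
have capl1 U V : U \in VV -> V \in VV -> (l1 <= \dim (U :&: V))%N.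
  have neq_le U' V' : U' \in VV -> V' \in VV -> U' != V' -> (l1 <= \dim (U' :&: V'))%N.
    move=> UVV VVV /(capl _ _ UVV VVV); rewrite inE => /orP[/eqP-> // | ].
    by move/allP: (order_path_min ltn_trans l_sorted) => l1l /l1l/ltnW.
  move=> UVV VVV; have [<- | neUV] := eqVneq U V; last exact: neq_le.
  (* For U = V, a second member W gives l1 <= dim(U :&: W) <= dim U. *)
  have /hasP[W WVV neUW] : has (fun W => U != W) VV.
    apply: contraLR s_gt1; rewrite -all_predC -leqNgt => /allP allU.
    apply: (@uniq_leq_size _ VV [:: U]) => // W /allU /=.
    by rewrite negbK inE eq_sym.
  rewrite capvv; apply: leq_trans (neq_le _ _ UVV WVV neUW) _.
  exact/dimvS/capvSl.
have [/existsP[D /andP[l1D /allP sDV]]|/existsPn noW] :=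
    boolP [exists W : subspace, (l1 <= \dim W)%N && all (subsetv W) VV].
  (* Shrinking the common subspace to dimension exactly l1 matches the n - l1 of the bound. *)
  have [W sWD dW] := subspace_of_dim l1D; rewrite -dW.
  apply: (@size_star_le _ _ (l1 :: l)) => // [V /sDV|i /Kgt]; last by rewrite dW.
  exact: subv_trans.
apply: le_trans (gauss_binom_sum_mul_le _ _ _ leq_n) => //; last exact: gauss_binom_ge0.
rewrite -subnS; apply: size_nonstar_le => //.
- exact: ltnW.
- by move=> i /Kgt; lia.
- by move=> W l1W; have := noW W; rewrite l1W.
Qed.

End Families.

(** Since x >= 1, its logarithm is nonnegative; hence m <= n and the truncated n - m is the true
    difference. *)
Lemma log_base_le_nat (R : realType) (b x : R) (m n : nat) :
  1 < b -> 1 <= x -> log_base b x + m%:R <= n%:R ->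
  (m <= n)%N /\ x <= b ^+ (n - m).
Proof.
move=> b_gt1 x_ge1; have x_gt0 : 0 < x by apply: lt_le_trans x_ge1.
have lnb_gt0 : 0 < ln b by apply: ln_gt0.
have b_gt0 : 0 < b by apply: lt_trans b_gt1.
rewrite /log_base -lerBrDr => le_log.
have le_mn : (m <= n)%N.
  rewrite -(ler_nat R) -subr_ge0; apply: le_trans le_log.
  by rewrite divr_ge0 ?ln_ge0 // ltW.
split=> //; move: le_log; rewrite -natrB // ler_pdivrMr // mulr_natl -lnXn //.
by rewrite ler_ln // posrE exprn_gt0.
Qed.

(* MathComp world. [l] lists l_1 < ... < l_s, [ks] lists k_1, ..., k_r, and
   [VV] lists the distinct members of the collection. The guard [i <= s] drops
   the Gaussian binomials with negative lower index, which are zero. *)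
Theorem theorem1p16 (R : realType) (F : finFieldType) (vT : vectType F)
    (q n s r k l1 : nat) (l : s.-tuple nat) (ks : r.-tuple nat)
    (VV : seq {vspace vT})
    (hq : #|F| = q)
    (hn : \dim {: vT} = n)
    (hs : (0 < s)%N)
    (hl : sorted ltn l)
    (hl1 : l1 = nth 0%N l 0)
    (hks : uniq ks)
    (hksl : forall i : 'I_r, s%:Z - r%:Z + l1%:Z < (tnth ks i)%:Z)
    (hVV : uniq VV)
    (hcap : forall U W : {vspace vT}, U \in VV -> W \in VV -> U != W ->
       \dim (U :&: W)%VS \in l)
    (hdim : forall U : {vspace vT}, U \in VV -> \dim U \in ks)
    (hk : k = \max_(U <- VV) \dim U)
    (hnlog : log_base (q%:R : R)
               ((q%:R ^+ s - 1) * gauss_binom R q (k ^ 2) l1.+1 + 1) + l1%:R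
             <= n%:R) :
  (size VV)%:R <= \sum_(i < r | (i <= s)%N) gauss_binom R q (n - l1) (s - i).
Proof.
(* [vT] and [finvect_type vT] are convertible only for an explicit record. *)
case: vT VV hn hVV hcap hdim hk => T cT VV hn hVV hcap hdim hk.
case: s l hs hl hl1 hksl hcap hnlog => // s l _.
case/tupleP: l => l0 l; move=> /= hl -> hksl hcap.
subst q n; have q_gt1 := card_finField_gt1 F.
case/log_base_le_nat=> [||le_n leq_n].
- by rewrite ltr1n.
- rewrite lerDr mulr_ge0 ?gauss_binom_ge0 // subr_ge0 exprn_ege1 //.
  by rewrite ler1n ltnW.
have := @size_Lintersecting_le R F (Vector.Pack cT) l ks VV l0 k hVV hl hcap hdim.
rewrite !size_tuple; apply=> // [V VVV | i].
  rewrite hk; pose dim_of (U : {vspace Vector.Pack cT}) := \dim U.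
  exact: (@leq_bigmax_seq _ VV xpredT dim_of).
by case/tnthP=> j eq_i; have := hksl j; rewrite -eq_i; lia.
Qed.
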